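(* Let $R>0$ be real, let $v,\Gamma_s\in\mathbb{R}$, and let $\omega$ be a complex-valued function given for $|k|<R$ by its Taylor series around $k=0$, which has radius of convergence $R$ and the form $$\omega(k)=vk-i\frac{\Gamma_s}{2}k^2+\ldots,$$ where the dots denote terms of order $k^3$ and higher (with arbitrary complex coefficients). Suppose that $\operatorname{Im}\omega(k)\le|\operatorname{Im} k|$ for all $k\in\mathbb{C}$ with $|k|<R$. Then $$|v|\le 1,\qquad 0\le\frac{\Gamma_s}{2}\le\frac{16}{3\pi}\frac{1}{R},$$ and moreover $$\frac{\Gamma_s}{2}\le 4\sqrt{\frac{2}{3}}\left(\frac{8}{\sqrt{6}\,\pi}-|v|\right)\frac{1}{R}.$$ *)

(* Defs.v *)
(* Stdlib reals with Coquelicot (complex numbers and power series). *)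
From Stdlib Require Import Reals.
From Coquelicot Require Import Coquelicot.

Open Scope R_scope.

(* Coquelicot's [CV_radius] covers real coefficients only.  Nothing is required
   on the circle [Cmod k = rho] itself. *)
Definition is_CV_radius_C (a : nat -> C) (rho : R) : Prop :=
  (forall k : C, Cmod k < rho -> @ex_pseries C_AbsRing C_NormedModule a k) /\
  (forall k : C, rho < Cmod k -> ~ @ex_pseries C_AbsRing C_NormedModule a k).

(* Main.v *)
(* Fix 0 < r < rho.  On the circle k = r e^{i x} the function
   r |sin x| - Im omega(k) is nonnegative, so its integral against the weight
   2 (sin x + b)^2 >= 0 is nonnegative.  That weight is a trigonometric
   polynomial of degree 2, hence it only sees the Taylor coefficients of order
   at most 2, and the resulting inequality is
     4 pi b v r + pi (Gamma_s / 2) r^2 <= (16/3 + 8 b^2) r.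
   The choices b = 0 and b = +- sqrt(2/3), followed by r -> rho, give the upper
   bounds.  The bounds |v| <= 1 and Gamma_s >= 0 come from k -> 0 along the
   imaginary and the real axis.
   To avoid interchanging series and integral, the weight is integrated against
   Taylor polynomials, with a geometric bound on the remainder. *)
Require Import Defs.
From Stdlib Require Import Reals Lra Lia.
From Coquelicot Require Import Coquelicot.

Open Scope R_scope.

(** * Taylor terms on a circle about the origin *)

Definition polar (r x : R) : C := (r * cos x, r * sin x).

Definition harmonic (c s : R) (n : nat) (x : R) : R :=
  c * cos (INR n * x) + s * sin (INR n * x).

(** For a_n = p + i q, the imaginary part of a_n r^n e^{i n x} is r^n (q cos nx + p sin nx); hence
    [Im] comes before [Re] in the arguments of [harmonic]. *)
Definition im_term (a : nat -> C) (r x : R) (n : nat) : R :=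
  r ^ n * harmonic (Im (a n)) (Re (a n)) n x.

(** Its Fourier form is 1 + 2 b^2 + 4 b sin x - cos 2x: the sine detects v, the cosine detects
    Gamma_s, and b remains free for optimisation. *)
Definition weight (b x : R) : R := 2 * (sin x + b) ^ 2.

Lemma Cmod_polar (r x : R) : 0 <= r -> Cmod (polar r x) = r.
Proof.
  intros Hr. unfold Cmod, polar. simpl.
  replace (_ + _) with (r * r * (Rsqr (sin x) + Rsqr (cos x))) by (unfold Rsqr; ring).
  rewrite sin2_cos2, Rmult_1_r. now apply sqrt_square.
Qed.

Lemma pow_n_polar (r x : R) (n : nat) :
  @pow_n C_Ring (polar r x) n = polar (r ^ n) (INR n * x).
Proof.
  induction n as [|n IH].
  - unfold polar; simpl. rewrite Rmult_0_l, cos_0, sin_0, !Rmult_1_l. reflexivity.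
  - simpl pow_n. rewrite IH.
    rewrite S_INR, Rmult_plus_distr_r, Rmult_1_l. unfold polar.
    rewrite cos_plus, sin_plus.
    change mult with Cmult. unfold Cmult; simpl. f_equal; ring.
Qed.

(** * Convergence, coefficient bounds and remainders *)

Lemma is_series_fst (u : nat -> C) (l : C) :
  @is_series C_AbsRing C_NormedModule u l -> is_series (fun n => fst (u n)) (fst l).
Proof.
  intros H.
  assert (E : forall n, sum_n (fun n => fst (u n)) n
                        = fst (@sum_n (NormedModule.AbelianMonoid C_AbsRing C_NormedModule) u n)).
  { induction n as [|n IH]; [now rewrite !sum_O | now rewrite !sum_Sn, IH]. }
  (* Balls in [C] are products of real balls, so [fst] pulls a neighbourhood of [fst l] back to one
     of [l]. *)
  intros P [e He]. destruct (H (fun z => P (fst z))) as [N HN].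
  - exists e. intros z [Hz _]. now apply He.
  - exists N. intros n Hn. rewrite E. now apply HN.
Qed.

Lemma is_series_snd (u : nat -> C) (l : C) :
  @is_series C_AbsRing C_NormedModule u l -> is_series (fun n => snd (u n)) (snd l).
Proof.
  intros H.
  assert (E : forall n, sum_n (fun n => snd (u n)) n
                        = snd (@sum_n (NormedModule.AbelianMonoid C_AbsRing C_NormedModule) u n)).
  { induction n as [|n IH]; [now rewrite !sum_O | now rewrite !sum_Sn, IH]. }
  intros P [e He]. destruct (H (fun z => P (snd z))) as [N HN].
  - exists e. intros z [_ Hz]. now apply He.
  - exists N. intros n Hn. rewrite E. now apply HN.
Qed.

Lemma is_series_im_term (a : nat -> C) (r x : R) (l : C) :
  @is_pseries C_AbsRing C_NormedModule a (polar r x) l ->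
  is_series (im_term a r x) (Im l).
Proof.
  intros H. apply is_series_snd in H.
  eapply is_series_ext; [|exact H]. intros n. cbv beta.
  change (@pow_n C_AbsRing) with (@pow_n C_Ring).
  rewrite pow_n_polar. change scal with Cmult. unfold Cmult, polar, im_term, harmonic, Re, Im; simpl. ring.
Qed.

Lemma is_series_bounded (u : nat -> R) (l : R) :
  is_series u l -> exists M : R, forall n, Rabs (u n) <= M.
Proof.
  intros H.
  assert (L : is_lim_seq u 0) by (apply ex_series_lim_0; now exists l).
  apply is_lim_seq_Reals in L.
  destruct (maj_by_pos u) as [M [_ HM]].
  - now exists 0.
  - now exists M.
Qed.

(** Convergence at the single real point r bounds r^n Re a_n and r^n Im a_n separately; since |cos|
    and |sin| are at most 1, the bound is uniform in the angle. *)
Lemma coef_bounded (a : nat -> C) (r : R) (l : C) :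
  @is_pseries C_AbsRing C_NormedModule a (polar r 0) l ->
  exists M : R, forall n x, Rabs (r ^ n * harmonic (Im (a n)) (Re (a n)) n x) <= M.
Proof.
  intros H.
  assert (E : forall n, @scal C_AbsRing C_NormedModule (@pow_n C_AbsRing (polar r 0) n) (a n)
                        = (r ^ n * Re (a n), r ^ n * Im (a n))).
  { intros n. change (@pow_n C_AbsRing) with (@pow_n C_Ring).
    rewrite pow_n_polar. change scal with Cmult.
    unfold Cmult, polar, Re, Im; simpl.
    rewrite Rmult_0_r, cos_0, sin_0. f_equal; ring. }
  destruct (is_series_bounded _ _ (is_series_fst _ _ H)) as [M1 H1].
  destruct (is_series_bounded _ _ (is_series_snd _ _ H)) as [M2 H2].
  exists (M2 + M1). intros n x. specialize (H1 n). specialize (H2 n).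
  rewrite E in H1, H2. simpl in H1, H2. unfold harmonic.
  replace (_ * _) with (r ^ n * Im (a n) * cos (INR n * x) + r ^ n * Re (a n) * sin (INR n * x)) by ring.
  eapply Rle_trans; [apply Rabs_triang|]. rewrite !Rabs_mult in *.
  assert (Hc : Rabs (cos (INR n * x)) <= 1) by (apply Rabs_le, COS_bound).
  assert (Hs : Rabs (sin (INR n * x)) <= 1) by (apply Rabs_le, SIN_bound).
  pose proof (Rabs_pos (r ^ n)). pose proof (Rabs_pos (Im (a n))). pose proof (Rabs_pos (Re (a n))).
  apply Rplus_le_compat.
  - rewrite <- (Rmult_1_r M2). apply Rmult_le_compat; try apply Rabs_pos; nra.
  - rewrite <- (Rmult_1_r M1). apply Rmult_le_compat; try apply Rabs_pos; nra.
Qed.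

Lemma geometric_tail (u : nat -> R) (l M q : R) (N : nat) :
  is_series u l -> 0 <= q < 1 -> (forall n, Rabs (u n) <= M * q ^ n) ->
  Rabs (l - sum_n u N) <= M * q ^ S N / (1 - q).
Proof.
  intros Hu Hq Hb.
  assert (G : is_series (fun k => M * q ^ S N * q ^ k) (M * q ^ S N * / (1 - q))).
  { apply (is_series_scal_l (V := R_NormedModule)), is_series_geom. rewrite Rabs_pos_eq; lra. }
  assert (B : forall k, Rabs (u (S N + k)%nat) <= M * q ^ S N * q ^ k).
  { intros k. rewrite Rmult_assoc, <- pow_add. apply Hb. }
  assert (X : ex_series (fun k => Rabs (u (S N + k)%nat))).
  { apply (ex_series_le (K := R_AbsRing) (V := R_CompleteNormedModule)) with (b := fun k => M * q ^ S N * q ^ k).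
    - intros k. change norm with Rabs. rewrite Rabs_Rabsolu. apply B.
    - eexists; exact G. }
  rewrite <- (is_series_unique _ _ Hu), (Series_incr_n u (S N)); [|lia|now exists l].
  rewrite sum_n_Reals. simpl pred.
  replace (_ - _) with (Series (fun k => u (S N + k)%nat)) by ring.
  eapply Rle_trans; [now apply Series_Rabs|].
  unfold Rdiv. rewrite <- (is_series_unique _ _ G).
  apply Series_le; [|eexists; exact G].
  intros k. split; [apply Rabs_pos|apply B].
Qed.

(** * Integrals against the weight over a period *)

Lemma is_RInt_FTC (F f : R -> R) (a b v : R) :
  (forall x, is_derive F x (f x)) -> (forall x, ex_derive f x) ->
  F b - F a = v -> is_RInt f a b v.
Proof.
  intros HF Hf <-.
  apply (is_RInt_derive (V := R_CompleteNormedModule) F f).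
  - intros x _. apply HF.
  - intros x _. apply (ex_derive_continuous (V := R_NormedModule)), Hf.
Qed.

Lemma is_RInt_harmonic (c s : R) (n : nat) :
  (0 < n)%nat -> is_RInt (harmonic c s n) 0 (2 * PI) 0.
Proof.
  intros Hn. assert (Hn' : INR n <> 0) by (apply not_0_INR; lia).
  apply is_RInt_FTC with (F := fun x => c * sin (INR n * x) / INR n - s * cos (INR n * x) / INR n).
  - intros x. unfold harmonic. auto_derive; [easy|field; easy].
  - intros x. unfold harmonic. auto_derive. easy.
  - replace (INR n * (2 * PI)) with (0 + 2 * INR n * PI) by ring.
    rewrite sin_period, cos_period, Rmult_0_r. field; easy.
Qed.

(** By the product-to-sum formulas, a frequency n + 3 times the weight splits into the frequencies n
    + 1, ..., n + 5. All are positive, so each integrates to zero. *)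
Lemma is_RInt_weight_harmonic (b c s : R) (n : nat) :
  is_RInt (fun x => weight b x * harmonic c s (S (S (S n))) x) 0 (2 * PI) 0.
Proof.
  pose (h1 := harmonic ((1 + 2 * b ^ 2) * c) ((1 + 2 * b ^ 2) * s) (n + 3)).
  pose (h2 := harmonic (- (2 * b * s)) (2 * b * c) (n + 4)).
  pose (h3 := harmonic (2 * b * s) (- (2 * b * c)) (n + 2)).
  pose (h4 := harmonic (- (c / 2)) (- (s / 2)) (n + 5)).
  pose (h5 := harmonic (- (c / 2)) (- (s / 2)) (n + 1)).
  apply is_RInt_ext with (f := fun x => h1 x + (h2 x + (h3 x + (h4 x + h5 x)))).
  - intros x _. unfold h1, h2, h3, h4, h5, weight, harmonic.
    replace (S (S (S n))) with (n + 3)%nat by lia.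
    rewrite !plus_INR. set (m := INR n). simpl INR.
    replace ((m + (1 + 1 + 1 + 1)) * x) with ((m + (1 + 1 + 1)) * x + x) by ring.
    replace ((m + (1 + 1 + 1 + 1 + 1)) * x) with ((m + (1 + 1 + 1)) * x + 2 * x) by ring.
    replace ((m + 1) * x) with ((m + (1 + 1 + 1)) * x - 2 * x) by ring.
    replace ((m + (1 + 1)) * x) with ((m + (1 + 1 + 1)) * x - x) by ring.
    set (y := (m + (1 + 1 + 1)) * x).
    (* The terms in sin 2x cancel between [h4] and [h5], so only cos 2x has to be expressed through
       sin x. *)
    rewrite !cos_plus, !cos_minus, !sin_plus, !sin_minus, (cos_2a_sin x).
    match goal with |- ?u = ?w => change (@eq R u w) end. field.
  - replace 0 with (0 + (0 + (0 + (0 + 0)))) at 2 by ring.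
    repeat apply (is_RInt_plus (V := R_NormedModule)); apply is_RInt_harmonic; lia.
Qed.

Lemma sin_sqr_pow (x : R) : sin x ^ 2 = 1 - cos x ^ 2.
Proof. pose proof (sin2_cos2 x) as H. unfold Rsqr in H. lra. Qed.

Lemma is_RInt_weight (b : R) :
  is_RInt (weight b) 0 (2 * PI) (2 * PI * (1 + 2 * b ^ 2)).
Proof.
  apply is_RInt_FTC with
    (F := fun x => (1 + 2 * b ^ 2) * x - sin x * cos x - 4 * b * cos x).
  - intros x. unfold weight. auto_derive; [easy|]. pose proof (sin_sqr_pow x). nra.
  - intros x. unfold weight. auto_derive. easy.
  - rewrite sin_2PI, cos_2PI, sin_0, cos_0. ring.
Qed.

(** Named because it is evaluated on both half-periods (for |sin|) and on the full period (for
    sin). *)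
Definition weight_sin_primitive (b x : R) : R :=
  2 * (cos x ^ 3 / 3 - cos x) + 2 * b * (x - sin x * cos x) - 2 * b ^ 2 * cos x.

Lemma is_RInt_weight_sin (b u w : R) :
  is_RInt (fun x => weight b x * sin x) u w
    (weight_sin_primitive b w - weight_sin_primitive b u).
Proof.
  apply is_RInt_FTC with (F := weight_sin_primitive b); [| |easy].
  - intros x. unfold weight, weight_sin_primitive. auto_derive; [easy|].
    replace (2 * (sin x + b) ^ 2 * sin x)
      with (2 * sin x ^ 2 * sin x + 4 * b * sin x ^ 2 + 2 * b ^ 2 * sin x) by ring.
    pose proof (sin_sqr_pow x) as E.
    replace (_ + _) with (2 * (1 - cos x ^ 2) * sin x + 2 * b * (1 - cos x ^ 2 + sin x ^ 2) + 2 * b ^ 2 * sin x)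
      by (field).
    rewrite E. ring.
  - intros x. unfold weight. auto_derive. easy.
Qed.

(** Splitting at pi, where sin changes sign, gives 8/3 + 4 b^2 + 2 pi b and 8/3 + 4 b^2 - 2 pi b;
    the parts linear in b cancel. *)
Lemma is_RInt_weight_abs_sin (b : R) :
  is_RInt (fun x => weight b x * Rabs (sin x)) 0 (2 * PI) (16 / 3 + 8 * b ^ 2).
Proof.
  pose proof PI_RGT_0.
  pose proof (is_RInt_weight_sin b 0 PI) as H1.
  pose proof (is_RInt_opp _ _ _ _ (is_RInt_weight_sin b PI (2 * PI))) as H2.
  replace (16 / 3 + 8 * b ^ 2)
    with (plus (weight_sin_primitive b PI - weight_sin_primitive b 0)
            (opp (weight_sin_primitive b (2 * PI) - weight_sin_primitive b PI))).
  - apply (is_RInt_Chasles (V := R_NormedModule)) with PI.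
    + eapply is_RInt_ext; [|exact H1]. intros x. rewrite Rmin_left, Rmax_right by lra.
      intros Hx. rewrite Rabs_pos_eq; [easy|]. apply sin_ge_0; lra.
    + eapply is_RInt_ext; [|exact H2]. intros x. rewrite Rmin_left, Rmax_right by lra.
      intros Hx. rewrite Rabs_left1; [exact (Ropp_mult_distr_r _ _)|]. apply sin_le_0; lra.
  - change plus with Rplus. change opp with Ropp. unfold weight_sin_primitive.
    rewrite sin_2PI, cos_2PI, sin_PI, cos_PI, sin_0, cos_0.
    match goal with |- ?u = ?w => change (@eq R u w) end. field.
Qed.

Lemma is_RInt_weight_cos2 (b : R) :
  is_RInt (fun x => weight b x * cos (2 * x)) 0 (2 * PI) (- PI).
Proof.
  (* The first three terms are sin 2x / 2 - x / 2 - sin 4x / 8, a primitive of cos 2x - cos^2 2x.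
     Only - x / 2 is not periodic, and it produces - pi. *)
  apply is_RInt_FTC with
    (F := fun x => sin x * cos x - x / 2 - sin x * cos x * (2 * cos x ^ 2 - 1) / 2
                   - 4 * b * cos x - 8 * b * (cos x ^ 3 / 3 - cos x) + 2 * b ^ 2 * (sin x * cos x)).
  - intros x. unfold weight. auto_derive; [easy|]. rewrite cos_2a_cos.
    pose proof (sin_sqr_pow x) as E. field [E].
  - intros x. unfold weight. auto_derive. easy.
  - rewrite sin_2PI, cos_2PI, sin_0, cos_0. field.
Qed.

(** * Taylor polynomials against the weight *)

Lemma im_sum_1 (a : nat -> C) (v r x : R) :
  a 0%nat = RtoC 0 -> a 1%nat = RtoC v ->
  sum_n (im_term a r x) 1 = v * r * sin x.
Proof.
  intros a0 a1. rewrite sum_Sn, sum_O. unfold im_term, harmonic. rewrite a0, a1.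
  change plus with Rplus. simpl. replace (1 * x) with x by ring.
  match goal with |- ?u = ?w => change (@eq R u w) end. ring.
Qed.

Lemma im_sum_2 (a : nat -> C) (v g r x : R) :
  a 0%nat = RtoC 0 -> a 1%nat = RtoC v -> a 2%nat = (- (Ci * RtoC g))%C ->
  sum_n (im_term a r x) 2 = v * r * sin x - g * r ^ 2 * cos (2 * x).
Proof.
  intros a0 a1 a2. rewrite sum_Sn, (im_sum_1 a v) by easy.
  unfold im_term, harmonic. rewrite a2.
  change plus with Rplus. simpl. change (1 + 1) with 2.
  match goal with |- ?u = ?w => change (@eq R u w) end. ring.
Qed.

(** The base case is the quadratic polynomial, with 4 pi b from sin x and - pi from cos 2x. Every
    later term is orthogonal to the weight, so the value is independent of N. *)
Lemma is_RInt_weight_im_sum (a : nat -> C) (v g b r : R) (N : nat) :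
  a 0%nat = RtoC 0 -> a 1%nat = RtoC v -> a 2%nat = (- (Ci * RtoC g))%C ->
  is_RInt (fun x => weight b x * sum_n (im_term a r x) (S (S N))) 0 (2 * PI)
    (4 * PI * b * v * r + PI * g * r ^ 2).
Proof.
  intros a0 a1 a2. induction N as [|N IH].
  - pose proof (is_RInt_scal _ _ _ (v * r) _ (is_RInt_weight_sin b 0 (2 * PI))) as H1.
    pose proof (is_RInt_scal _ _ _ (- g * r ^ 2) _ (is_RInt_weight_cos2 b)) as H2.
    pose proof (is_RInt_plus (V := R_NormedModule) _ _ _ _ _ _ H1 H2) as H.
    replace (4 * PI * b * v * r + PI * g * r ^ 2)
      with (plus (scal (v * r) (weight_sin_primitive b (2 * PI) - weight_sin_primitive b 0))
                 (scal (- g * r ^ 2) (- PI))).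
    + eapply is_RInt_ext; [|exact H]. intros x _.
      rewrite (im_sum_2 a v g) by easy. change plus with Rplus. change scal with Rmult.
      match goal with |- ?u = ?w => change (@eq R u w) end. ring.
    + change plus with Rplus. change scal with Rmult. unfold weight_sin_primitive.
      rewrite sin_2PI, cos_2PI, sin_0, cos_0.
      match goal with |- ?u = ?w => change (@eq R u w) end. field.
  - pose proof (is_RInt_scal _ _ _ (r ^ S (S (S N))) _
      (is_RInt_weight_harmonic b (Im (a (S (S (S N))))) (Re (a (S (S (S N))))) N)) as H1.
    pose proof (is_RInt_plus (V := R_NormedModule) _ _ _ _ _ _ IH H1) as H.
    replace (4 * PI * b * v * r + PI * g * r ^ 2)
      with (plus (4 * PI * b * v * r + PI * g * r ^ 2) (scal (r ^ S (S (S N))) 0)).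
    + eapply is_RInt_ext; [|exact H]. intros x _.
      rewrite (sum_Sn _ (S (S N))). unfold im_term at 3.
      change plus with Rplus. change scal with Rmult.
      match goal with |- ?u = ?w => change (@eq R u w) end. ring.
    + change plus with Rplus. change scal with Rmult.
      match goal with |- ?u = ?w => change (@eq R u w) end. ring.
Qed.

(** Here [e] is a truncation error uniform in the angle; it gets multiplied by the total mass of the
    weight. *)
Lemma weighted_bound (a : nat -> C) (v g b r e : R) (N : nat) :
  a 0%nat = RtoC 0 -> a 1%nat = RtoC v -> a 2%nat = (- (Ci * RtoC g))%C ->
  (forall x, sum_n (im_term a r x) (S (S N)) <= r * Rabs (sin x) + e) ->
  4 * PI * b * v * r + PI * g * r ^ 2
    <= r * (16 / 3 + 8 * b ^ 2) + e * (2 * PI * (1 + 2 * b ^ 2)).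
Proof.
  intros a0 a1 a2 H. pose proof PI_RGT_0.
  pose proof (is_RInt_plus (V := R_NormedModule) _ _ _ _ _ _
    (is_RInt_scal _ _ _ r _ (is_RInt_weight_abs_sin b))
    (is_RInt_scal _ _ _ e _ (is_RInt_weight b))) as H1.
  refine (is_RInt_le _ _ 0 (2 * PI) _ _ _ (is_RInt_weight_im_sum a v g b r N a0 a1 a2) H1 _); [lra|].
  intros x _. change plus with Rplus. change scal with Rmult. cbv beta.
  assert (0 <= weight b x) by (unfold weight; pose proof (pow2_ge_0 (sin x + b)); lra).
  eapply Rle_trans; [apply Rmult_le_compat_l; [easy|apply H]|]. apply Req_le. ring.
Qed.

(** * Remainder estimates and passage to the limit *)

Lemma im_sum_bound (rho : R) (omega : C -> C) (a : nat -> C) (r1 : R) :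
  (forall k : C, Cmod k < rho ->
     @is_pseries C_AbsRing C_NormedModule a k (omega k)) ->
  (forall k : C, Cmod k < rho -> Im (omega k) <= Rabs (Im k)) ->
  0 < r1 < rho ->
  exists M : R, 0 <= M /\ forall r x N, 0 <= r < r1 ->
    sum_n (im_term a r x) N
      <= r * Rabs (sin x) + M * (r / r1) ^ S N / (1 - r / r1).
Proof.
  intros Ht Hi Hr1.
  (* The constant depends only on the circle of radius r1, so it serves both for N to infinity at
     fixed r and for r to 0 at fixed N. *)
  destruct (coef_bounded a r1 (omega (polar r1 0))) as [M HM].
  { apply Ht. rewrite Cmod_polar; lra. }
  exists M. split. { eapply Rle_trans; [apply Rabs_pos|apply (HM 0%nat 0)]. }
  intros r x N Hr.
  assert (Hk : Cmod (polar r x) < rho) by (rewrite Cmod_polar; lra).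
  assert (Hq : 0 <= r / r1 < 1).
  { split; [apply Rdiv_le_0_compat; lra|]. apply (Rdiv_lt_1 r r1); lra. }
  assert (HT : Rabs (Im (omega (polar r x)) - sum_n (im_term a r x) N)
               <= M * (r / r1) ^ S N / (1 - r / r1)).
  { apply geometric_tail; [apply is_series_im_term, Ht, Hk|exact Hq|].
    intros n. unfold im_term.
    (* This factorisation turns boundedness on the circle of radius r1 into geometric decay of ratio
       r / r1. *)
    replace r with (r1 * (r / r1)) at 1 by (field; lra).
    rewrite Rpow_mult_distr, Rmult_assoc, (Rmult_comm (_ ^ n) (harmonic _ _ _ _)), <- Rmult_assoc, Rabs_mult.
    assert (0 <= (r / r1) ^ n) by (apply pow_le; lra).
    rewrite (Rabs_pos_eq ((r / r1) ^ n)) by easy.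
    apply Rmult_le_compat_r; [easy|apply HM]. }
  specialize (Hi _ Hk). unfold polar at 2 in Hi. simpl in Hi.
  rewrite Rabs_mult, (Rabs_pos_eq r) in Hi by lra.
  apply Rabs_le_between in HT. lra.
Qed.

Lemma le_of_le_add_linear (d u w K : R) :
  0 < d -> (forall r, 0 < r <= d -> u <= w + K * r) -> u <= w.
Proof.
  intros Hd H. apply le_epsilon. intros e He.
  pose proof (Rabs_pos K) as HK. pose proof (Rle_abs K).
  (* The added 1 keeps the denominator positive when K = 0. *)
  assert (Hp : 0 < e / (Rabs K + 1)) by (apply Rdiv_lt_0_compat; lra).
  set (p := e / (Rabs K + 1)) in *.
  assert (E : p * (Rabs K + 1) = e) by (unfold p; field; lra).
  pose proof (Rmin_l d p). pose proof (Rmin_r d p).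
  assert (0 < Rmin d p) by now apply Rmin_glb_lt.
  specialize (H (Rmin d p)). nra.
Qed.

Lemma circle_bound (rho : R) (omega : C -> C) (a : nat -> C) (v g b r : R) :
  (forall k : C, Cmod k < rho ->
     @is_pseries C_AbsRing C_NormedModule a k (omega k)) ->
  (forall k : C, Cmod k < rho -> Im (omega k) <= Rabs (Im k)) ->
  a 0%nat = RtoC 0 -> a 1%nat = RtoC v -> a 2%nat = (- (Ci * RtoC g))%C ->
  0 < r < rho ->
  4 * PI * b * v + PI * g * r <= 16 / 3 + 8 * b ^ 2.
Proof.
  intros Ht Hi a0 a1 a2 Hr.
  (* The midpoint radius is strictly between r and rho: the series converges there, and the ratio q
     is below 1. *)
  destruct (im_sum_bound rho omega a ((r + rho) / 2) Ht Hi) as [M [HM H]]; [lra|].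
  set (q := r / ((r + rho) / 2)) in *.
  assert (Hq : 0 <= q < 1).
  { unfold q. split; [apply Rdiv_le_0_compat; lra|]. apply (Rdiv_lt_1 r); lra. }
  apply Rmult_le_reg_l with r; [lra|].
  (* The polynomial of order N + 2 has a remainder of order q^(N + 3), which vanishes as N grows. *)
  assert (L : is_lim_seq
    (fun N => r * (16 / 3 + 8 * b ^ 2)
              + M * q ^ S (S (S N)) / (1 - q) * (2 * PI * (1 + 2 * b ^ 2)))
    (r * (16 / 3 + 8 * b ^ 2))).
  { replace (r * (16 / 3 + 8 * b ^ 2)) with
      (r * (16 / 3 + 8 * b ^ 2) + M / (1 - q) * (2 * PI * (1 + 2 * b ^ 2)) * 0) at 1 by ring.
    apply is_lim_seq_ext with
      (fun N => r * (16 / 3 + 8 * b ^ 2) + M / (1 - q) * (2 * PI * (1 + 2 * b ^ 2)) * q ^ (N + 3)).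
    { intros N. replace (N + 3)%nat with (S (S (S N))) by lia. field. lra. }
    apply is_lim_seq_plus'; [apply is_lim_seq_const|].
    apply (is_lim_seq_scal_l _ _ 0), (is_lim_seq_incr_n (fun N => q ^ N)), is_lim_seq_geom.
    rewrite Rabs_pos_eq; lra. }
  replace (r * (4 * PI * b * v + PI * g * r)) with (4 * PI * b * v * r + PI * g * r ^ 2) by ring.
  refine (is_lim_seq_le _ _ (Finite _) (Finite _) _ (is_lim_seq_const _) L).
  intros N. apply weighted_bound with a N; try easy.
  intros x. apply H. lra.
Qed.

Lemma origin_bounds (rho : R) (omega : C -> C) (a : nat -> C) (v g : R) :
  0 < rho ->
  (forall k : C, Cmod k < rho ->
     @is_pseries C_AbsRing C_NormedModule a k (omega k)) ->
  (forall k : C, Cmod k < rho -> Im (omega k) <= Rabs (Im k)) ->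
  a 0%nat = RtoC 0 -> a 1%nat = RtoC v -> a 2%nat = (- (Ci * RtoC g))%C ->
  Rabs v <= 1 /\ 0 <= g.
Proof.
  intros Hrho Ht Hi a0 a1 a2. pose (p := rho / 2).
  assert (Hp : 0 < p < rho) by (unfold p; lra).
  destruct (im_sum_bound rho omega a p Ht Hi Hp) as [M [HM H]].
  (* Keeping r below p / 2 makes the ratio at most 1/2, so 1 / (1 - r / p) is at most 2, the source
     of the factor 2. *)
  assert (B : forall r x N, 0 < r <= p / 2 ->
    sum_n (im_term a r x) N <= r * Rabs (sin x) + 2 * M / p ^ S N * r ^ S N).
  { intros r x N Hr. eapply Rle_trans; [apply H; lra|]. apply Rplus_le_compat_l.
    assert (Hq : 0 <= r / p <= / 2).
    { split; [apply Rdiv_le_0_compat; lra|]. apply Rmult_le_reg_r with p; [lra|]. field_simplify; lra. }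
    replace (2 * M / p ^ S N * r ^ S N) with (M * (r / p) ^ S N * 2).
    - apply Rmult_le_compat_l.
      + apply Rmult_le_pos; [easy|]. apply pow_le; lra.
      + rewrite <- (Rinv_inv 2). apply Rinv_le_contravar; lra.
    - unfold Rdiv. rewrite Rpow_mult_distr, pow_inv. field. apply pow_nonzero; lra. }
  assert (V : forall r x, 0 < r <= p / 2 -> v * sin x <= Rabs (sin x) + 2 * M / p ^ 2 * r).
  { intros r x Hr. specialize (B r x 1%nat Hr).
    rewrite (im_sum_1 a v) in B by easy.
    apply Rmult_le_reg_l with r; [lra|]. revert B. generalize (2 * M / p ^ 2). intros K B. simpl in B. lra. }
  repeat split.
  - apply Rabs_le. split.
    + cut (v * sin (- (PI / 2)) <= Rabs (sin (- (PI / 2)))).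
      { rewrite sin_neg, sin_PI2, Rabs_Ropp, Rabs_R1. lra. }
      apply le_of_le_add_linear with (p / 2) (2 * M / p ^ 2); [lra|]. intros r. apply V.
    + cut (v * sin (PI / 2) <= Rabs (sin (PI / 2))).
      { rewrite sin_PI2, Rabs_R1. lra. }
      apply le_of_le_add_linear with (p / 2) (2 * M / p ^ 2); [lra|]. intros r. apply V.
  (* At angle 0 both |Im k| and the linear term vanish, leaving - g r^2 <= K r^3, to be divided by
     r^2. *)
  - cut (- g <= 0); [lra|].
    apply le_of_le_add_linear with (p / 2) (2 * M / p ^ 3); [lra|]. intros r Hr.
    specialize (B r 0 2%nat Hr).
    rewrite (im_sum_2 a v g), sin_0, !Rmult_0_r, cos_0, Rabs_R0 in B by easy.
    apply Rmult_le_reg_l with (r ^ 2); [apply pow_lt; lra|].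
    revert B. generalize (2 * M / p ^ 3). intros K B. simpl in *. lra.
Qed.

Theorem theorem3 (rho : R) (hrho : 0 < rho) (v Gamma_s : R)
    (omega : C -> C) (a : nat -> C)
    (hradius : is_CV_radius_C a rho)
    (htaylor : forall k : C, Cmod k < rho ->
       @is_pseries C_AbsRing C_NormedModule a k (omega k))
    (ha0 : a 0%nat = RtoC 0)
    (ha1 : a 1%nat = RtoC v)
    (ha2 : a 2%nat = (- (Ci * RtoC (Gamma_s / 2)))%C)
    (hIm : forall k : C, Cmod k < rho -> Im (omega k) <= Rabs (Im k)) :
  Rabs v <= 1 /\
  (0 <= Gamma_s / 2 <= 16 / (3 * PI) * (1 / rho)) /\
  Gamma_s / 2 <= 4 * sqrt (2 / 3) * (8 / (sqrt 6 * PI) - Rabs v) * (1 / rho).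
Proof.
  set (g := Gamma_s / 2) in *.
  destruct (origin_bounds rho omega a v g) as [Hv Hg]; try easy.
  assert (HPI := PI_RGT_0).
  (* The limit r to rho is taken with r = rho - d, which costs pi g d; d <= rho / 2 keeps r
     positive. *)
  assert (HB : forall b, 4 * PI * b * v + PI * g * rho <= 16 / 3 + 8 * b ^ 2).
  { intros b. apply le_of_le_add_linear with (rho / 2) (PI * g); [lra|]. intros d Hd.
    pose proof (circle_bound rho omega a v g b (rho - d) htaylor hIm ha0 ha1 ha2).
    lra. }
  split; [exact Hv|]. split; [split; [exact Hg|]|].
  - specialize (HB 0).
    apply Rmult_le_reg_l with (PI * rho); [nra|].
    replace (PI * rho * (16 / (3 * PI) * (1 / rho))) with (16 / 3) by (field; lra). lra.
  (* The value b = sqrt (2/3) minimises (16/3 + 8 b^2) / (4 pi b) over b > 0, with minimum 8 / (sqrt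
     6 pi), the constant in the claim. *)
  - set (s := sqrt (2 / 3)).
    assert (Hs : s * s = 2 / 3) by (apply sqrt_sqrt; lra).
    assert (H6 : 0 < sqrt 6) by (apply sqrt_lt_R0; lra).
    assert (Hs6 : sqrt 6 = 3 * s).
    { replace 6 with (3 * 3 * (2 / 3)) by field.
      rewrite sqrt_mult, sqrt_square by lra. reflexivity. }
    rewrite Hs6 in *.
    apply Rmult_le_reg_l with (PI * rho); [nra|].
    replace (PI * rho * (4 * s * (8 / (3 * s * PI) - Rabs v) * (1 / rho)))
      with (32 / 3 - 4 * PI * s * Rabs v) by (field; lra).
    (* Giving b the sign of v turns b v into s |v|. *)
    pose proof (HB s). pose proof (HB (- s)).
    unfold Rabs. destruct (Rcase_abs v); nra.
Qed.
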